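(* Let $(P,\leq,{}',0,1)$ be an orthomodular poset and $a,b\in P$. Then the following hold: (i) if $a\leftrightarrow b$ then $a\mathrel\Delta b$, $b\mathrel\Delta a$ and $d(a,b)=\{1\}$; (ii) if $a\leq b$ then $a\mathrel\Delta b$, $b\mathrel\Delta a$ and $d(a,b)=\{1\}$.
   Context: An orthoposet is a tuple $(P,\leq,{}',0,1)$ where $(P,\leq,0,1)$ is a bounded poset and ${}'$ is a unary operation on $P$ such that $x\leq y$ implies $y'\leq x'$, $x''=x$, and for every $x$ the supremum $x\vee x'$ exists and equals $1$ and the infimum $x\wedge x'$ exists and equals $0$. Elements $x,y$ are orthogonal, $x\perp y$, if $x\leq y'$. An orthogonal poset is an orthoposet in which the supremum $x\vee y$ exists whenever $x\perp y$. An orthomodular poset is an orthogonal poset in which $x\leq y$ implies $x\vee(x\vee y')'=y$. For $A\subseteq P$ let $L(A)$ and $U(A)$ be the sets of all lower bounds and of all upper bounds of $A$ in $P$; several arguments (elements or subsets) denote the bounds of the union, e.g. $L(a,b)=L(\{a,b\})$, $U(A,B)=U(A\cup B)$. For $a,b\in P$: $a\mathrel\Delta b$ means $U(a)=U(L(a,b),L(a,b'))$; $a\leftrightarrow b$ means that there exist $c,d,e\in P$ with $c\perp d\perp e\perp c$, $a=c\vee d$ and $b=d\vee e$; $d(a,b):=U(L(a,b),L(a,b'),L(a',b),L(a',b'))$. *)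

(* Defs.v *)
From HB Require Import structures.
From mathcomp Require Import all_boot all_order.
From mathcomp Require Import boolp classical_sets.

Set Implicit Arguments.
Unset Strict Implicit.
Unset Printing Implicit Defensive.

Import Order.TTheory.
Local Open Scope classical_set_scope.
Local Open Scope order_scope.

(* Binary suprema and infima are partial in a poset, hence relational:
   [is_sup2 x y s] means that the supremum of x and y exists and equals s. *)
Definition is_sup2 (d : Order.disp_t) (P : porderType d) (x y s : P) : Prop :=
  supremums [set x; y] s.

Definition is_inf2 (d : Order.disp_t) (P : porderType d) (x y i : P) : Prop :=
  infimums [set x; y] i.

HB.mixin Record isOrthoposet (d : Order.disp_t) P of Order.TBPOrder d P := {
  ocompl : P -> P;
  ocompl_anti : forall x y : P, x <= y -> ocompl y <= ocompl x;
  ocomplK : forall x : P, ocompl (ocompl x) = x;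
  ocompl_sup : forall x : P, is_sup2 x (ocompl x) (\top : P);
  ocompl_inf : forall x : P, is_inf2 x (ocompl x) (\bot : P)
}.

#[short(type="orthoposetType")]
HB.structure Definition Orthoposet (d : Order.disp_t) :=
  { P of Order.TBPOrder d P & isOrthoposet d P }.

Definition orthogonal (d : Order.disp_t) (P : orthoposetType d) (x y : P)
  : Prop := x <= ocompl y.

HB.mixin Record isOrthogonalPoset (d : Order.disp_t) P of Orthoposet d P := {
  orthogonal_sup : forall x y : P, orthogonal x y -> exists s, is_sup2 x y s
}.

#[short(type="orthogonalPosetType")]
HB.structure Definition OrthogonalPoset (d : Order.disp_t) :=
  { P of Orthoposet d P & isOrthogonalPoset d P }.

(* The law x \/ (x \/ y')' = y, with s the inner join. Both joins exist by
   orthogonality, so the existential only names s. *)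
HB.mixin Record isOrthomodularPoset (d : Order.disp_t) P
    of OrthogonalPoset d P := {
  orthomodular_law : forall x y : P, x <= y ->
    exists2 s, is_sup2 x (ocompl y) s & is_sup2 x (ocompl s) y
}.

#[short(type="orthomodularPosetType")]
HB.structure Definition OrthomodularPoset (d : Order.disp_t) :=
  { P of OrthogonalPoset d P & isOrthomodularPoset d P }.

Section Relations.
Context (d : Order.disp_t) (P : orthoposetType d).
Implicit Types a b : P.

Definition Delta a b : Prop :=
  ubound [set a] = ubound (lbound [set a; b] `|` lbound [set a; ocompl b]).

Definition compatible a b : Prop :=
  exists c d e : P,
    [/\ [/\ orthogonal c d, orthogonal d e & orthogonal e c],
        is_sup2 c d a & is_sup2 d e b].

Definition dset a b : set P :=
  ubound (lbound [set a; b] `|` lbound [set a; ocompl b]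
          `|` lbound [set ocompl a; b] `|` lbound [set ocompl a; ocompl b]).

End Relations.

(* Main.v *)
Require Import Defs.
From HB Require Import structures.
From mathcomp Require Import all_boot all_order.
From mathcomp Require Import boolp classical_sets.

Set Implicit Arguments.
Unset Strict Implicit.
Unset Printing Implicit Defensive.

Import Order.TTheory.
Local Open Scope classical_set_scope.
Local Open Scope order_scope.

(** If [a = c \/ e] and [b = e \/ f] with [c, e, f] pairwise orthogonal, then
    [e] is a common lower bound of [a, b], while [c] lies in [L(a, b')] and [f]
    in [L(a', b)].  Hence an upper bound of the relevant lower cones dominates
    [a] or [b].  For [d(a, b)], the complement of [s = c \/ b] lies in
    [L(a', b')], so an upper bound dominates both [s] and [s'] and equals 1.
    The case [a <= b] reduces to this one with [c = 0], [e = a] and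
    [f = (a \/ b')'], by orthomodularity. *)

Lemma is_sup2P (d : Order.disp_t) (P : porderType d) (x y s : P) :
  is_sup2 x y s <->
  [/\ x <= s, y <= s & forall u, x <= u -> y <= u -> s <= u].
Proof.
split=> [[ub lub]|[xs ys lub]].
  split=> [||u xu yu]; [by apply: ub; left|by apply: ub; right|].
  by apply: lub => z [->|->].
split=> [z [->|->] //|u ubu].
by apply: lub; apply: ubu; [left|right].
Qed.

Lemma is_sup2C (d : Order.disp_t) (P : porderType d) (x y s : P) :
  is_sup2 x y s -> is_sup2 y x s.
Proof. by rewrite /is_sup2 setUC. Qed.

Lemma lbound2 (d : Order.disp_t) (P : porderType d) (x y z : P) :
  z <= x -> z <= y -> lbound [set x; y] z.
Proof. by move=> zx zy w [->|->]. Qed.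

Section Orthoposet.
Context (d : Order.disp_t) (P : orthoposetType d).
Implicit Types a b c x y s : P.

Lemma orthogonalC x y : orthogonal x y -> orthogonal y x.
Proof. by rewrite /orthogonal => /ocompl_anti; rewrite ocomplK. Qed.

(** By symmetry of orthogonality, [x] and [y] both lie below [ocompl c], so their supremum does
    too. *)
Lemma orthogonal_is_sup2 c x y s :
  is_sup2 x y s -> orthogonal c x -> orthogonal c y -> orthogonal c s.
Proof.
move=> /is_sup2P[_ _ lub] cx cy.
by apply/orthogonalC/lub; apply: orthogonalC.
Qed.

Lemma compatibleC a b : compatible a b -> compatible b a.
Proof.
move=> [c [e [f [[ce ef fc] supa supb]]]].
exists f, e, c; split; [|exact: is_sup2C|exact: is_sup2C].
by split; apply: orthogonalC.
Qed.

Lemma compatible_Delta a b : compatible a b -> Delta a b.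
Proof.
move=> [c [e [f [[ce ef fc] supa supb]]]].
have cb : orthogonal c b.
  exact: orthogonal_is_sup2 supb ce (orthogonalC fc).
have /is_sup2P[ca ea luba] := supa; have /is_sup2P[eb _ _] := supb.
(* Both lower cones lie below [a], which gives the first inclusion. For the second, [cb] is what
   puts [c] below [ocompl b]. *)
apply/seteqP; split=> [u ub_u z|u ub_u _ ->].
  by move=> [lz|lz]; apply: le_trans (ub_u a erefl); apply: lz; left.
by apply: luba; apply: ub_u; [right|left]; apply: lbound2.
Qed.

End Orthoposet.

Lemma compatible_dset (d : Order.disp_t) (P : orthogonalPosetType d)
  (a b : P) : compatible a b -> dset a b = [set \top].
Proof.
move=> [c [e [f [[ce ef fc] supa supb]]]].
have cb : orthogonal c b.
  exact: orthogonal_is_sup2 supb ce (orthogonalC fc).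
have fa : orthogonal f a.
  exact: orthogonal_is_sup2 supa fc (orthogonalC ef).
have /is_sup2P[ca ea luba] := supa; have /is_sup2P[eb fb lubb] := supb.
(* [s] acts as the join of [c], [e] and [f]. It bounds [a] as well as [b], so [ocompl s] lies below
   both complements. *)
have [s /is_sup2P[cs bs lubs]] := orthogonal_sup _ _ cb.
have as_ : a <= s by apply: luba cs (le_trans eb bs).
apply/seteqP; split=> [u ub_u|_ -> z _]; last exact: lex1.
have eu : e <= u by apply: ub_u; left; left; left; apply: lbound2.
have cu : c <= u by apply: ub_u; left; left; right; apply: lbound2.
have fu : f <= u by apply: ub_u; left; right; apply: lbound2.
have s'u : ocompl s <= u.
  by apply: ub_u; right; apply: lbound2; apply: ocompl_anti.
have /is_sup2P[_ _ lubT] := ocompl_sup s.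
(* [u] bounds [e] and [f], hence [b]; with [c] it bounds [s], and with [ocompl s] it bounds the
   top. *)
by apply/le_anti; rewrite lex1 lubT // lubs // lubb.
Qed.

Lemma le_compatible (d : Order.disp_t) (P : orthomodularPosetType d)
  (a b : P) : a <= b -> compatible a b.
Proof.
move=> /orthomodular_law[s /is_sup2P[le_as _ _] supb].
exists \bot, a, (ocompl s); split=> //.
  (* The pair [a], [ocompl s] is orthogonal because the double complement of [s] is [s], which
     bounds [a]. *)
  split; rewrite /orthogonal ?le0x ?ocomplK //.
  by apply: orthogonalC; apply: le0x.
by apply/is_sup2P; split=> //; apply: le0x.
Qed.

Theorem lemma4p3 (d : Order.disp_t) (P : orthomodularPosetType d) (a b : P) :
  (compatible a b -> [/\ Delta a b, Delta b a & dset a b = [set \top]]) /\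
  (a <= b -> [/\ Delta a b, Delta b a & dset a b = [set \top]]).
Proof.
have main : compatible a b ->
    [/\ Delta a b, Delta b a & dset a b = [set \top]].
  move=> ab; split; [exact: compatible_Delta| |exact: compatible_dset].
  exact/compatible_Delta/compatibleC.
by split=> // /le_compatible.
Qed.
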